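(* Let $m\ge n \ge 2$ be integers. Then $$a_1(P_n \,\square\, P_m) = \begin{cases} 2; & (n = 2 \text{ and } 2 \le m \le 5), \text{ or } (n=3 \text{ and } m\in\{3,4\}),\\ 3; & (n = 2 \text{ and } m \ge 6), \text{ or } (n=3 \text{ and } 5 \le m \le 11), \text{ or } (n=4 \text{ and } 4 \le m \le 7), \text{ or } n=m=5,\\ 4; & \text{otherwise}, \end{cases}$$ and $$a_1'(P_n \,\square\, P_m) = \begin{cases} 2; & n=m=2,\\ 3; & n=2,\ m \ge 3,\\ 4; & m\ge n \ge 3. \end{cases}$$
   Context: $P_n$ is the path on $n$ vertices. The Cartesian product $G\,\square\, H$ of graphs $G$ and $H$ has vertex set $V(G)\times V(H)$, with $(g,h)$ and $(g',h')$ adjacent if either $gg'\in E(G)$ and $h=h'$, or $g=g'$ and $hh'\in E(H)$. A clique of a graph $G$ is an inclusion-wise maximal complete subgraph. The $(a,b)$-monochromatic clique transversal game ($(a,b)$-MCT game) on $G$ is played by Alice and Bob, who alternately take turns: in each of her turns Alice chooses $a$ unplayed vertices and colors them red, and in each of his turns Bob chooses $b$ unplayed vertices and colors them blue (if fewer unplayed vertices remain, the player colors all of them). Alice wins if the red vertices contain at least one vertex of each clique of $G$; Bob wins if all vertices of some clique of $G$ are blue. The game is Alice-start or Bob-start depending on who moves first. The threshold $a_1(G)$ (resp. $a_1'(G)$) is the smallest positive integer $a$ such that Alice has a winning strategy in the Alice-start (resp. Bob-start) $(a,1)$-MCT game on $G$. *)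

(* Defs.v *)
From mathcomp Require Import all_boot.

Set Implicit Arguments.
Unset Strict Implicit.
Unset Printing Implicit Defensive.

(** A finite simple graph is a finite type of vertices with a (symmetric and
    irreflexive) adjacency relation. *)

Definition path_graph (n : nat) : rel 'I_n :=
  fun i j => (i.+1 == j :> nat) || (j.+1 == i :> nat).

Definition cartesian_product (T U : finType) (e : rel T) (f : rel U) :
    rel (T * U) :=
  fun p q => (e p.1 q.1 && (p.2 == q.2)) || ((p.1 == q.1) && f p.2 q.2).

Lemma path_graph_sym n : symmetric (@path_graph n).
Proof. by move=> i j; rewrite /path_graph orbC. Qed.

Lemma path_graph_irr n : irreflexive (@path_graph n).
Proof. by move=> i; rewrite /path_graph orbb gtn_eqF. Qed.

Lemma cartesian_product_sym (T U : finType) (e : rel T) (f : rel U) :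
  symmetric e -> symmetric f -> symmetric (cartesian_product e f).
Proof.
move=> es fs p q.
by rewrite /cartesian_product es fs (eq_sym p.1) (eq_sym p.2).
Qed.

Lemma cartesian_product_irr (T U : finType) (e : rel T) (f : rel U) :
  irreflexive e -> irreflexive f -> irreflexive (cartesian_product e f).
Proof. by move=> ei fi p; rewrite /cartesian_product ei fi andbF. Qed.

Definition complete_set (T : finType) (e : rel T) (K : {set T}) : bool :=
  [forall x in K, forall y in K, (x != y) ==> e x y].

Definition is_clique (T : finType) (e : rel T) (K : {set T}) : bool :=
  maxset (complete_set e) K.

Definition clique_transversal (T : finType) (e : rel T) (R : {set T}) : bool :=
  [forall K : {set T}, is_clique e K ==> (R :&: K != set0)].

(** The state of a game is its history [h]: the list of the sets of vertices
    colored in the successive turns, most recent turn first.  The boolean [s]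
    is [true] in the Alice-start game and [false] in the Bob-start game. *)

Definition alice_turn (s : bool) (k : nat) : bool := odd k != s.

Definition played (T : finType) (h : seq {set T}) : {set T} :=
  \bigcup_(A <- h) A.

Fixpoint red (T : finType) (s : bool) (h : seq {set T}) : {set T} :=
  if h is A :: h' then
    if alice_turn s (size h') then A :|: red s h' else red s h'
  else set0.

Definition legal_move (T : finType) (c : nat) (h : seq {set T}) (A : {set T}) :
    bool :=
  (A \subset ~: played h) && (#|A| == minn c #|~: played h|).

(** The value of a strategy matters only at the histories where it is Alice's
    turn; requiring legality at the others too is no restriction. *)
Definition alice_strategy (T : finType) (a : nat)
    (sigma : seq {set T} -> {set T}) : Prop :=
  forall h, played h != setT -> legal_move a h (sigma h).

(** Histories that can arise when Alice follows [sigma]. *)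
Inductive reachable (T : finType) (b : nat) (s : bool)
    (sigma : seq {set T} -> {set T}) : seq {set T} -> Prop :=
| reachable_start : reachable b s sigma [::]
| reachable_alice h :
    reachable b s sigma h -> played h != setT -> alice_turn s (size h) ->
    reachable b s sigma (sigma h :: h)
| reachable_bob h A :
    reachable b s sigma h -> played h != setT -> ~~ alice_turn s (size h) ->
    legal_move b h A -> reachable b s sigma (A :: h).

(** The outcome is read off once all vertices are colored: a player who has
    already won cannot lose the win by playing on, and in a full coloring the
    red vertices miss some clique exactly when that clique is entirely blue. *)
Definition alice_wins (T : finType) (e : rel T) (a b : nat) (s : bool) : Prop :=
  exists sigma : seq {set T} -> {set T},
    alice_strategy a sigma /\
    forall h, reachable b s sigma h -> played h = setT ->
      clique_transversal e (red s h).

Definition is_threshold (T : finType) (e : rel T) (s : bool) (k : nat) : Prop :=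
  [/\ 0 < k, alice_wins e k 1 s &
      forall a, 0 < a -> alice_wins e a 1 s -> k <= a].

(** [is_a1 e k] is a_1(G) = k, and [is_a1' e k] is a_1'(G) = k. *)
Definition is_a1 (T : finType) (e : rel T) (k : nat) : Prop :=
  is_threshold e true k.

Definition is_a1' (T : finType) (e : rel T) (k : nat) : Prop :=
  is_threshold e false k.

(* Main.v *)
(* In a triangle-free graph without isolated vertices the cliques are the edges,
   so Alice must prevent Bob from owning both ends of an edge. If Bob can play a
   vertex with more than [a] unplayed neighbours, Alice cannot take them all and
   Bob wins at once. Conversely, if after Alice's opening [S] no vertex outside
   [S] has more than [a] neighbours outside [S], she wins by answering each move
   of Bob with all unplayed neighbours of his vertex. Hence the Bob-start
   threshold is the maximum degree, and in the Alice-start game [a] suffices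
   exactly when some [S] of size at most [a] leaves a graph of maximum degree at
   most [a]. The latter property passes to induced subgraphs, so the lower bounds
   for all grids follow from those for the 2x2, 2x6, 3x5, 4x4, 3x12, 4x8 and 5x6
   grids, which are checked by a branching search. *)
Require Import Defs.
From mathcomp Require Import all_boot zify.

Set Implicit Arguments.
Unset Strict Implicit.
Unset Printing Implicit Defensive.

Definition neighbours (T : finType) (e : rel T) (v : T) : {set T} :=
  [set w | e v w].

(** A bound on the maximum degree of the subgraph induced on the complement of [S]. *)
Definition residual_degree_le (T : finType) (e : rel T) (a : nat) (S : {set T}) :=
  forall v, v \notin S -> #|neighbours e v :\: S| <= a.

(** * Cliques and edges *)

Section EdgeCliques.

Variables (T : finType) (e : rel T).
Hypotheses (es : symmetric e) (ei : irreflexive e).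

Lemma complete_set_edge x y : e x y -> complete_set e [set x; y].
Proof.
move=> exy; apply/forall_inP => u; rewrite !inE => /orP[]/eqP->;
by apply/forall_inP => w; rewrite !inE => /orP[]/eqP->;
  rewrite ?eqxx // ?(es y x) exy implybT.
Qed.

(** Every clique contains an edge: an empty set or a single vertex is not maximal, since no vertex
    is isolated. *)
Lemma clique_transversal_of_edges (x0 : T) (R : {set T}) :
  (forall x, exists y, e x y) ->
  (forall x y, e x y -> (x \in R) || (y \in R)) -> clique_transversal e R.
Proof.
move=> e1 cov; apply/forallP => K; apply/implyP => /maxsetP[cK maxK].
have [x xK] : exists x, x \in K.
  apply/set0Pn; apply/negP => /eqP K0.
  have [y exy] := e1 x0.
  have /setP/(_ x0) := maxK _ (complete_set_edge exy) ltac:(by rewrite K0 sub0set).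
  by rewrite K0 !inE eqxx.
have [y exy yK] : exists2 y, e x y & y \in K.
  have [y /andP[yK yx]|Kx] := pickP (fun y => (y \in K) && (y != x)).
    exists y => //.
    by move/forall_inP/(_ x xK)/forall_inP/(_ y yK): cK; rewrite eq_sym yx.
  have [y exy] := e1 x; exists y => //.
  rewrite -(maxK _ (complete_set_edge exy)) ?set22 //.
  apply/subsetP => z zK; have := Kx z.
  by rewrite zK /= => /negbFE/eqP->; rewrite set21.
by apply/set0Pn; case/orP: (cov _ _ exy) => ?; [exists x|exists y]; apply/setIP.
Qed.

(** Without triangles an edge is a maximal complete set, because a third vertex joined to both ends
    would close a triangle. *)
Lemma edge_of_clique_transversal (R : {set T}) x y :
  (forall x y z, e x y -> e y z -> ~~ e x z) ->
  clique_transversal e R -> e x y -> (x \in R) || (y \in R).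
Proof.
move=> e3 /forallP/(_ [set x; y])/implyP tR exy.
have /tR/set0Pn[z /setIP[zR]] : is_clique e [set x; y].
  apply/maxsetP; split=> [|K cK sK]; first exact: complete_set_edge.
  apply/eqP; rewrite eqEsubset sK andbT; apply/subsetP => z zK.
  have [xK yK] : x \in K /\ y \in K.
    by split; apply: (subsetP sK); rewrite !inE eqxx ?orbT.
  rewrite !inE; apply/norP => -[zx zy].
  have cKe u w : u \in K -> w \in K -> u != w -> e u w.
    by move=> uK wK; move/forall_inP/(_ u uK)/forall_inP/(_ w wK)/implyP: cK.
  have := e3 x y z exy; rewrite (cKe y z) 1?eq_sym // (cKe x z) 1?eq_sym //.
  by move/(_ isT).
by rewrite !inE => /orP[]/eqP<-; rewrite zR ?orbT.
Qed.

End EdgeCliques.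

(** * Extending a desired reply to a move of legal size *)

Section Padding.

Variable T : finType.

(** Listing [X :&: A] first makes the cut at [c] keep all of it whenever it fits; the rest of [A]
    only fills the move up to the required size. *)
Definition pad (c : nat) (X A : {set T}) : {set T} :=
  [set x in take c (enum (X :&: A) ++ enum (A :\: X))].

Lemma pad_sub c X A : pad c X A \subset A.
Proof.
apply/subsetP => x; rewrite inE => /mem_take.
by rewrite mem_cat !mem_enum !inE => /orP[]/andP[].
Qed.

Lemma card_pad c X A : #|pad c X A| = minn c #|A|.
Proof.
rewrite cardsE; have /card_uniqP-> : uniq (take c (enum (X :&: A) ++ enum (A :\: X))).
  rewrite take_uniq // cat_uniq !enum_uniq andbT /=; apply/hasPn => x.
  by rewrite !mem_enum !inE => /andP[/negPf->].
by rewrite size_take_min size_cat -!cardE setIC cardsID.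
Qed.

Lemma sub_pad c X A : #|X :&: A| <= c -> X :&: A \subset pad c X A.
Proof.
move=> Xc; apply/subsetP => x xX; rewrite inE take_cat -cardE.
by case: ltngtP Xc => // _ _; rewrite mem_cat mem_enum xX.
Qed.

End Padding.

(** * Alice's answering strategy and Bob's double threat *)

Section Game.

Variables (T : finType) (e : rel T).
Hypotheses (es : symmetric e) (ei : irreflexive e).
Implicit Types (h : seq {set T}) (s : bool).

Lemma played_cons A h : played (A :: h) = A :|: played h.
Proof. by rewrite /played big_cons. Qed.

Lemma played0 : played [::] = set0 :> {set T}.
Proof. by rewrite /played big_nil. Qed.

Lemma red_sub_played s h : red s h \subset played h.
Proof.
elim: h => [|A h IH] /=; first exact: sub0set.
rewrite played_cons; case: ifP => _; first exact: setUS.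
exact: subset_trans IH (subsetUr _ _).
Qed.

Lemma alice_turnS s k : alice_turn s k.+1 = ~~ alice_turn s k.
Proof. by rewrite /alice_turn /=; case: odd s => [] []. Qed.

Lemma legal_move1P h A :
  played h != setT -> legal_move 1 h A ->
  exists2 v, v \notin played h & A = [set v].
Proof.
move=> hT /andP[sA cA].
have h0 : 0 < #|~: played h|.
  by rewrite card_gt0; apply: contraNneq hT => h0; rewrite -(setCK (played h)) h0 setC0.
have /cards1P[v Av] : #|A| == 1 by rewrite (eqP cA); apply/eqP/minn_idPl.
by exists v => //; move: sA; rewrite Av sub1set inE.
Qed.

Lemma legal_move_set1 h v : v \notin played h -> legal_move 1 h [set v].
Proof.
move=> vh; rewrite /legal_move sub1set inE vh cards1 eq_sym /=.
by apply/eqP/minn_idPl/card_gt0P; exists v; rewrite inE.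
Qed.

(** At Alice's turn the head of a nonempty history is Bob's last move, a singleton, so the union is
    the neighbourhood of his vertex. Alice faces the empty history only when she starts, and then
    opens with [S]. *)
Definition shadow_target (S : {set T}) h : {set T} :=
  if h is A :: _ then \bigcup_(v in A) neighbours e v else S.

Definition shadow_strategy (a : nat) (S : {set T}) h : {set T} :=
  pad a (shadow_target S h) (~: played h).

(** This is meant for positions with Bob to move. A played vertex that is not red is blue, so the
    second clause says that all neighbours of blue vertices are red. *)
Definition safe (a : nat) s h :=
  residual_degree_le e a (played h) /\
  forall x y, x \in played h -> x \notin red s h -> e x y -> y \in red s h.

(** At Alice's turn the position itself need not be safe; what is kept is that it was safe before
    Bob's last vertex. *)
Definition shadow_invariant (a : nat) (S : {set T}) s h : Prop :=
  if alice_turn s (size h) then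
    if h is A :: h' return Prop then
      [/\ safe a s h', ~~ alice_turn s (size h')
        & exists2 v, v \notin played h' & A = [set v]]
    else #|S| <= a
  else safe a s h.

Lemma residual_degree_leW a b (S : {set T}) :
  a <= b -> residual_degree_le e a S -> residual_degree_le e b S.
Proof. by move=> ab dS v vS; apply: leq_trans (dS v vS) ab. Qed.

Lemma residual_degree_le_sub a (S S' : {set T}) :
  S \subset S' -> residual_degree_le e a S -> residual_degree_le e a S'.
Proof.
move=> sS dS v vS'; apply: leq_trans (dS v (contra (subsetP sS v) vS')).
by apply: subset_leq_card; apply: setDS.
Qed.

Lemma shadow_invariant_reachable a (S : {set T}) s h :
  #|S| <= a -> residual_degree_le e a S -> (~~ s -> S = set0) ->
  reachable 1 s (shadow_strategy a S) h -> shadow_invariant a S s h.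
Proof.
move=> Sa dS S0; elim=> [|{}h _ IH hT ha|{}h A _ IH hT hb lA].
- rewrite /shadow_invariant /=; case: ifP => //; rewrite /alice_turn /= => /negbFE/eqP s0.
  (* In the Bob-start game the empty position must already be safe, which is where [S = set0]
     enters. *)
  split; first by rewrite played0 -S0 // -s0.
  by move=> x y; rewrite played0 inE.
- move: IH; rewrite /shadow_invariant /= alice_turnS ha /=.
  case: h hT ha => [|A h] hT ha.
    rewrite /safe played_cons played0 setU0 /= ha setU0 => _.
    have sS : S \subset shadow_strategy a S [::].
      rewrite /shadow_strategy /= played0 setC0 -{1}(setIT S).
      by apply: sub_pad; rewrite setIT.
    by split=> [|x y ->]; first exact: residual_degree_le_sub dS.
  case=> -[dh rh] hb [v vh Av]; rewrite {}Av in hT ha *.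
  pose X := shadow_strategy a S ([set v] :: h); rewrite -/X.
  (* Since [v] was unplayed in a safe position, at most [a] of its neighbours are unplayed, and
     [pad] drops none of them. *)
  have sX : neighbours e v :\: played ([set v] :: h) \subset X.
    have := @sub_pad _ a (neighbours e v) (~: played ([set v] :: h)).
    rewrite /X /shadow_strategy /= big_set1 -setDE; apply.
    apply: leq_trans (dh v vh); apply: subset_leq_card; apply: setDS.
    by rewrite played_cons subsetUr.
  move: X sX => X sX; split.
    apply: residual_degree_le_sub dh.
    by rewrite 2!played_cons setUA subsetUr.
  move=> x y; rewrite /= ha (negPf hb) played_cons in_setU.
  rewrite in_setU negb_or => /orP[xX|]; first by rewrite xX.
  rewrite played_cons !inE => /orP[/eqP->|xh] /andP[xX xr] exy; last first.
    by rewrite (rh x y) ?orbT.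
  case yX : (y \in X) => //=.
  have : y \in played ([set v] :: h).
    apply: contraFT yX => yh; apply: (subsetP sX); rewrite in_setD yh inE.
    exact: exy.
  rewrite played_cons !inE => /orP[/eqP yv|yh]; first by rewrite yv ei in exy.
  (* If the earlier neighbour [y] of [v] were blue, safety would have made [v] red before Bob chose
     it. *)
  apply: contraNT vh => yr; apply: (subsetP (red_sub_played s h)).
  by apply: (rh y v); rewrite // es.
- move: IH; rewrite /shadow_invariant /= alice_turnS (negPf hb) /= => sh.
  by split=> //; apply: legal_move1P.
Qed.

Lemma shadow_invariant_cover a S s h x y :
  shadow_invariant a S s h -> played h = setT -> e x y ->
  (x \in red s h) || (y \in red s h).
Proof.
rewrite /shadow_invariant => + hT exy; case: ifP => [ha|_ [_ rh]]; last first.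
  by case xr : (x \in _) => //=; apply: (rh x y); rewrite ?hT ?xr.
case: h hT ha => [|A h] hT ha.
  by move/setP/(_ x): hT; rewrite played0 !inE.
case=> -[_ rh] hb [v vh Av] /=; rewrite (negPf hb).
(* If the game ends with Bob's move [v], the edge still has an end other than [v], which was played
   in the preceding safe position. *)
wlog xh : x y exy / x \in played h.
  move=> W; have : x \in played (A :: h) by rewrite hT.
  rewrite played_cons Av !inE => /orP[/eqP xv|xh]; last exact: W.
  have : y \in played (A :: h) by rewrite hT.
  rewrite played_cons Av !inE => /orP[/eqP yv|yh].
    by move: exy; rewrite xv yv ei.
  by rewrite orbC; apply: W; rewrite 1?es.
by case xr : (x \in red s h) => //=; apply: (rh x y); rewrite ?xr.
Qed.

Lemma alice_wins_of_residual_degree (x0 : T) a (S : {set T}) s :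
  (forall x, exists y, e x y) ->
  #|S| <= a -> residual_degree_le e a S -> (~~ s -> S = set0) ->
  alice_wins e a 1 s.
Proof.
move=> e1 Sa dS S0; exists (shadow_strategy a S); split=> [h _|h rh hT].
  by rewrite /legal_move pad_sub card_pad eqxx.
apply: clique_transversal_of_edges => // x y.
exact/shadow_invariant_cover/hT/(shadow_invariant_reachable Sa dS S0 rh).
Qed.

(** Play can always be continued, as each move colors at least one vertex, and later moves touch
    only unplayed vertices, so no blue vertex turns red. This is needed because the outcome is read
    off only from full colorings. *)
Lemma reachable_completion a s sigma h :
  0 < a -> alice_strategy a sigma -> reachable 1 s sigma h ->
  exists h', [/\ reachable 1 s sigma h', played h' = setT
               & red s h' :&: played h \subset red s h].
Proof.
move=> a0 ls; have [k] := ubnP #|~: played h|; elim: k h => // k IH h hk rh.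
have [hT|hT] := eqVneq (played h) setT; first by exists h; rewrite subsetIl.
have [v vh] : exists v, v \notin played h.
  have : ~: played h != set0.
    by apply: contraNneq hT => h0; rewrite -(setCK (played h)) h0 setC0.
  by case/set0Pn => v; rewrite inE; exists v.
suff [A [rA sA /set0Pn[w wA]]] : exists A,
    [/\ reachable 1 s sigma (A :: h), A \subset ~: played h & A != set0].
  have [||h' [rh' h'T sh']] := IH (A :: h) => //.
    rewrite -ltnS; apply: leq_trans hk; rewrite ltnS; apply: proper_card; rewrite played_cons setCU.
    apply/properP; split; first exact: subsetIr.
    by exists w; [exact: (subsetP sA)|rewrite !inE wA].
  exists h'; split=> //; apply/subsetP => x /setIP[xr xh].
  have : x \in red s (A :: h).
    by apply: (subsetP sh'); rewrite inE xr played_cons inE xh orbT.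
  rewrite /=; case: ifP => // _; rewrite inE => /orP[/(subsetP sA)|//].
  by rewrite inE xh.
case ha : (alice_turn s (size h)).
  exists (sigma h); have /andP[sA /eqP cA] := ls h hT.
  split=> //; first exact: reachable_alice.
  rewrite -card_gt0 cA leq_min a0; apply/card_gt0P; exists v; by rewrite inE.
exists [set v]; split; last by apply/set0Pn; exists v; rewrite inE.
  by apply: reachable_bob; rewrite ?ha ?legal_move_set1.
by rewrite sub1set inE.
Qed.

(* Bob plays [v], whose more than [a] unplayed neighbours Alice cannot all
   color, and then one of those left over. *)
Lemma residual_degree_of_winning a s sigma h :
  (forall x y z, e x y -> e y z -> ~~ e x z) -> 0 < a ->
  alice_strategy a sigma ->
  (forall h, reachable 1 s sigma h -> played h = setT ->
     clique_transversal e (red s h)) ->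
  reachable 1 s sigma h -> ~~ alice_turn s (size h) ->
  residual_degree_le e a (played h).
Proof.
move=> e3 a0 ls win rh hb v vh; rewrite leqNgt; apply/negP => dv.
have nT h' x : x \notin played h' -> played h' != setT.
  by apply: contraNneq => ->; rewrite inE.
pose h1 := [set v] :: h.
have rh1 : reachable 1 s sigma h1.
  by apply: reachable_bob => //; [exact: nT vh|exact: legal_move_set1].
(* As [v] is not its own neighbour, playing it leaves the count of its unplayed neighbours
   unchanged. *)
have dv1 : neighbours e v :\: played h1 = neighbours e v :\: played h.
  apply/setP => w; rewrite /h1 played_cons !inE negb_or andbAC.
  by rewrite [RHS]andbC; case: eqP => [->|_]; rewrite ?ei.
have h1T : played h1 != setT.
  have /card_gt0P[w] : 0 < #|neighbours e v :\: played h1|.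
    by rewrite dv1; apply: leq_ltn_trans dv.
  by rewrite in_setD => /andP[/nT].
pose h2 := sigma h1 :: h1.
have rh2 : reachable 1 s sigma h2.
  by apply: reachable_alice; rewrite //= alice_turnS hb.
have [w wh2 evw] : exists2 w, w \notin played h2 & e v w.
  have : ~~ (neighbours e v :\: played h1 \subset sigma h1).
    apply/negP => /subset_leq_card; rewrite leqNgt dv1.
    have /andP[_ /eqP->] := ls h1 h1T.
    by rewrite (leq_ltn_trans _ dv) ?geq_minl.
  case/subsetPn => w; rewrite 2!inE => /andP[wh1 evw] ws; exists w => //.
  by rewrite played_cons inE negb_or ws.
pose h3 := [set w] :: h2.
have rh3 : reachable 1 s sigma h3.
  apply: reachable_bob; rewrite ?legal_move_set1 //; first exact: nT wh2.
  by rewrite /= !alice_turnS hb.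
(* Bob now owns both ends of the edge [v w]; playing on to a full coloring contradicts Alice's
   win. *)
have [h' [rh' h'T sh']] := reachable_completion a0 ls rh3.
have red3 x : x \in red s h' -> x \in played h3 -> x \in sigma h1 :|: red s h.
  move=> xr xh; have := subsetP sh' x; rewrite inE xr xh => /(_ isT).
  by rewrite /= !alice_turnS (negPf hb).
have /andP[sX _] := ls h1 h1T.
have [vX wX] : v \notin sigma h1 :|: red s h /\ w \notin sigma h1 :|: red s h.
  have sr := subsetP (red_sub_played s h).
  move: wh2; rewrite /h2 /h1 !played_cons !in_setU !negb_or => /and3P[-> _ wh].
  rewrite (contra (sr w) wh) (contra (sr v) vh) andbT; split=> //.
  by apply/negP => /(subsetP sX); rewrite /h1 played_cons !inE eqxx.
have := edge_of_clique_transversal es e3 (win _ rh' h'T) evw.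
by case/orP=> /red3; rewrite /h3 /h2 /h1 !played_cons !inE eqxx ?orbT;
  move/(_ isT); rewrite -in_setU; [rewrite (negPf vX)|rewrite (negPf wX)].
Qed.

End Game.

(** * Thresholds in terms of residual degrees *)

Section Thresholds.

Variables (T : finType) (e : rel T).
Hypotheses (es : symmetric e) (ei : irreflexive e) (x0 : T).
Hypotheses (e1 : forall x, exists y, e x y).
Hypotheses (e3 : forall x y z, e x y -> e y z -> ~~ e x z).

(** For the lower bound, Alice's own opening serves as [S']. It suffices to exclude [k.-1], since
    for smaller [a] both the size bound and the degree bound are stronger. *)
Lemma is_a1_residual_degree k (S : {set T}) :
  0 < k -> #|S| <= k -> residual_degree_le e k S ->
  (forall S' : {set T}, #|S'| <= k.-1 -> ~ residual_degree_le e k.-1 S') ->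
  is_a1 e k.
Proof.
move=> k0 Sk dS low; split=> //; first exact: alice_wins_of_residual_degree dS _.
move=> a a0 [sigma [ls win]]; rewrite leqNgt; apply/negP => ak.
have ak1 : a <= k.-1 by rewrite -ltnS prednK.
have T0 : played [::] != [set: T].
  by apply/eqP => /setP/(_ x0); rewrite played0 !inE.
have rs : reachable 1 true sigma [:: sigma [::]].
  by apply: reachable_alice => //; exact: reachable_start.
have := residual_degree_of_winning es ei e3 a0 ls win rs isT.
rewrite played_cons played0 setU0 => /(residual_degree_leW ak1); apply: low.
have /andP[_ /eqP->] := ls [::] T0.
exact: leq_trans (geq_minl _ _) ak1.
Qed.

(** When Bob starts, the empty position plays the role of Alice's opening. *)
Lemma is_a1'_residual_degree k :
  0 < k -> residual_degree_le e k set0 -> ~ residual_degree_le e k.-1 set0 ->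
  is_a1' e k.
Proof.
move=> k0 dT low; split=> //.
  by apply: (@alice_wins_of_residual_degree _ _ _ _ x0 _ set0); rewrite ?cards0.
move=> a a0 [sigma [ls win]]; rewrite leqNgt; apply/negP => ak; apply: low.
have rs : reachable 1 false sigma [::] by exact: reachable_start.
have := residual_degree_of_winning es ei e3 a0 ls win rs isT.
by rewrite played0; apply: residual_degree_leW; rewrite -ltnS prednK.
Qed.

End Thresholds.

Notation grid n m := (cartesian_product (@path_graph n) (@path_graph m)).

(** * Degrees and triangle-freeness of grids *)

Section GridGraph.

Variables n m : nat.

Lemma grid_sym : symmetric (grid n m).
Proof. by apply: cartesian_product_sym; exact: path_graph_sym. Qed.

Lemma grid_irr : irreflexive (grid n m).
Proof. by apply: cartesian_product_irr; exact: path_graph_irr. Qed.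

(** The parity of the coordinate sum is a proper 2-coloring, which rules out triangles. *)
Lemma grid_parity p q : grid n m p q -> odd (q.1 + q.2) = ~~ odd (p.1 + p.2).
Proof.
rewrite /cartesian_product /path_graph !oddD.
by case/orP=> [/andP[/orP[]/eqP<- /eqP->]|/andP[/eqP-> /orP[]/eqP<-]] /=;
  do 2?case: odd.
Qed.

Lemma grid_triangle_free p q r :
  grid n m p q -> grid n m q r -> ~~ grid n m p r.
Proof.
move=> /grid_parity pq /grid_parity qr; apply/negP => /grid_parity.
by rewrite qr pq; case: odd.
Qed.

Lemma path_graph_neighbour k (i : 'I_k) : 1 < k -> exists j, path_graph i j.
Proof.
move=> k1; have [ik|ki] := ltnP i.+1 k.
  by exists (Ordinal ik); rewrite /path_graph eqxx.
have jk : i.-1 < k by rewrite (leq_ltn_trans (leq_pred i)).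
exists (Ordinal jk); rewrite /path_graph /= prednK ?eqxx ?orbT //; lia.
Qed.

Lemma grid_neighbour p : 1 < n -> exists q, grid n m p q.
Proof.
move=> n1; have [i pi] := path_graph_neighbour p.1 n1.
by exists (i, p.2); rewrite /cartesian_product pi eqxx.
Qed.

(** The bound 2 comes from predecessor and successor, the bound [k.-1] from excluding [i] itself.
    The latter is sharper for [k = 2] and gives degree 3 for two-row grids. *)
Lemma card_path_neighbours k (i : 'I_k) :
  #|neighbours (@path_graph k) i| <= minn 2 k.-1.
Proof.
rewrite leq_min; apply/andP; split.
  have -> : 2 = size [:: i.+1; i.-1] by [].
  rewrite cardE -(size_map val); apply: uniq_leq_size.
    by rewrite map_inj_uniq ?enum_uniq //; exact: val_inj.
  move=> x /mapP[j]; rewrite mem_enum !inE => + ->.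
  by rewrite /path_graph /= => /orP[]/eqP <-; rewrite eqxx ?orbT.
rewrite -[k in k.-1]card_ord -(cardsC1 i); apply: subset_leq_card.
apply/subsetP => j; rewrite !inE; apply: contraTneq => ->.
by rewrite path_graph_irr.
Qed.

Lemma card_grid_neighbours p :
  #|neighbours (grid n m) p| <= minn 2 n.-1 + minn 2 m.-1.
Proof.
have s : neighbours (grid n m) p \subset
    [set (i, p.2) | i in neighbours (@path_graph n) p.1] :|:
    [set (p.1, j) | j in neighbours (@path_graph m) p.2].
  apply/subsetP => -[i j]; rewrite !inE /cartesian_product /=.
  case/orP=> [/andP[pi /eqP<-]|/andP[/eqP<- pj]]; apply/orP.
    by left; apply/imsetP; exists i; rewrite ?inE.
  by right; apply/imsetP; exists j; rewrite ?inE.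
apply: leq_trans (subset_leq_card s) _; apply: leq_trans (leq_card_setU _ _) _.
by apply: leq_add; apply: leq_trans (leq_imset_card _ _) (card_path_neighbours _).
Qed.

Lemma grid_residual_degree k :
  minn 2 n.-1 + minn 2 m.-1 <= k -> residual_degree_le (grid n m) k set0.
Proof.
by move=> dk v _; rewrite setD0; apply: leq_trans (card_grid_neighbours v) dk.
Qed.

End GridGraph.

(** * A computable search on grids *)

Section GridComputation.

Implicit Types (p q : nat * nat) (s t : seq (nat * nat)).

Variables (n m a : nat).

(** Grid vertices are recoded as pairs of natural numbers in lists, so that the search runs by plain
    evaluation. *)
Definition grid_points : seq (nat * nat) :=
  [seq (i, j) | i <- iota 0 n, j <- iota 0 m].

(** Matching on the coordinates avoids the truncated predecessor of 0, so a vertex is never listed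
    as its own neighbour. *)
Definition adjacent_points p : seq (nat * nat) :=
  [seq q <- [:: (p.1.+1, p.2); (p.1, p.2.+1)]
         ++ (if p.1 is i.+1 then [:: (i, p.2)] else [::])
         ++ (if p.2 is j.+1 then [:: (p.1, j)] else [::])
   | (q.1 < n) && (q.2 < m)].

Definition heavy s p : bool :=
  (p \notin s) && (a < count [predC s] (adjacent_points p)).

(* If [p] is heavy for [s], an extension of [s] for which [p] is not heavy must
   contain [p] or one of its neighbours: branch over these. *)
Fixpoint no_light_extension (d : nat) s : bool :=
  if [seq p <- grid_points | heavy s p] is p :: _ then
    if d is d'.+1 then
      all (fun q => no_light_extension d' (q :: s)) (p :: adjacent_points p)
    else true
  else false.

Lemma eq_heavy s t : s =i t -> heavy s =1 heavy t.
Proof.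
move=> st p; rewrite /heavy st; congr (_ && (_ < _)).
by apply: eq_count => q; rewrite /= st.
Qed.

(** Induction on [d], with [p] the heavy point found. If [t] contains [p] or one of its neighbours,
    that point moves from [t] to [s]; otherwise [t] takes away neither [p] nor any neighbour, and
    [p] stays heavy. *)
Lemma no_light_extensionP d s t :
  no_light_extension d s -> size t <= d -> has (heavy (t ++ s)) grid_points.
Proof.
elim: d s t => [|d IH] s t /=; case E : [seq _ <- _ | _] => [//|p ps];
  have /andP[hp pG] : (heavy s p) && (p \in grid_points)
    by rewrite -mem_filter E mem_head.
  by move=> _; rewrite leqn0 => /nilP->; apply/hasP; exists p.
move=> Hall td.
have [/hasP[q qt qp]|/hasPn tp] := boolP (has (mem (p :: adjacent_points p)) t).
  have /allP/(_ q qp) nq : all (fun q => no_light_extension d (q :: s))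
    (p :: adjacent_points p) := Hall.
  have := IH _ (rem q t) nq.
  rewrite size_rem // -subn1 leq_subLR add1n td => /(_ isT).
  rewrite (eq_has (a2 := heavy (t ++ s))) //; apply: eq_heavy => x.
  rewrite mem_cat !inE mem_cat orbA [_ || (x == q)]orbC.
  by have /perm_mem/(_ x) := perm_to_rem qt; rewrite inE => ->.
apply/hasP; exists p => //; case/andP: hp => ps' ap; apply/andP; split.
  rewrite mem_cat negb_or ps' andbT; apply/negP => /tp.
  by rewrite /= inE eqxx.
apply: leq_trans ap _; apply: eq_leq; apply: eq_in_count => q qp /=.
rewrite mem_cat negb_or; case qt : (q \in t) => //=.
by have := tp q qt; rewrite /= inE qp orbT.
Qed.

Definition coords (v : 'I_n * 'I_m) : nat * nat := (val v.1, val v.2).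

Lemma coords_inj : injective coords.
Proof. by move=> [i j] [i' j'] [/val_inj-> /val_inj->]. Qed.

Lemma mem_grid_points p :
  reflect (exists v, p = coords v) (p \in grid_points).
Proof.
apply: (iffP allpairsP) => [[[i j]]|[[i j] ->]].
  rewrite !mem_iota /= !add0n => -[i_n j_m ->].
  by exists (Ordinal i_n, Ordinal j_m).
by exists (val i, val j); rewrite !mem_iota !ltn_ord.
Qed.

Lemma mem_adjacent_points v w :
  (coords w \in adjacent_points (coords v)) = grid n m v w.
Proof.
case: v w => [[i i_n] [j j_m]] [[i' i'_n] [j' j'_m]].
rewrite mem_filter /= i'_n j'_m /cartesian_product /path_graph /= -!val_eqE /=.
by case: i i_n => [|i] i_n; case: j j_m => [|j] j_m;
  rewrite !inE !xpair_eqE /=; lia.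
Qed.

Lemma perm_coords_neighbours v :
  perm_eq (map coords (enum (neighbours (grid n m) v))) (adjacent_points (coords v)).
Proof.
apply: uniq_perm; first by rewrite (map_inj_uniq coords_inj) enum_uniq.
  apply: filter_uniq; case: v => [[i _] [j _]] /=.
  by case: i => [|i]; case: j => [|j]; rewrite /= ?inE ?xpair_eqE; lia.
move=> p; apply/mapP/idP => [[w + ->]|pv].
  by rewrite mem_enum inE mem_adjacent_points.
have /mem_grid_points[w pw] : p \in grid_points.
  move: pv; rewrite mem_filter => /andP[/andP[p1 p2] _].
  by apply/mem_grid_points; exists (Ordinal p1, Ordinal p2); case: (p) p1 p2.
by exists w; rewrite // mem_enum inE -mem_adjacent_points -pw.
Qed.

Lemma heavy_coords (S : {set 'I_n * 'I_m}) s v :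
  (forall w, (coords w \in s) = (w \in S)) ->
  heavy s (coords v) = (v \notin S) && (a < #|neighbours (grid n m) v :\: S|).
Proof.
move=> sS; rewrite /heavy sS; congr (_ && (_ < _)).
rewrite -(permP (perm_coords_neighbours v)) count_map cardE /enum_mem size_filter.
by rewrite count_filter; apply: eq_count => w; rewrite /= !inE sS.
Qed.

Lemma residual_degree_coords (S : {set 'I_n * 'I_m}) s :
  (forall w, (coords w \in s) = (w \in S)) ->
  residual_degree_le (grid n m) a S <-> ~~ has (heavy s) grid_points.
Proof.
move=> sS; split=> [dS|/hasPn hs v vS].
  apply/hasPn => _ /mem_grid_points[v ->]; rewrite (heavy_coords _ sS) negb_and.
  by case: (boolP (v \in S)) => //= /dS; rewrite leqNgt.
have /hs : coords v \in grid_points by apply/mem_grid_points; exists v.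
by rewrite (heavy_coords _ sS) vS /= -leqNgt.
Qed.

End GridComputation.

(** * Transfer between grids and the search *)

(** The map [f] sends the neighbours of [v] outside the preimage injectively to neighbours of [f v]
    outside [S]. *)
Lemma residual_degree_le_preim (T U : finType) (e : rel T) (e' : rel U)
    (f : U -> T) a (S : {set T}) :
  injective f -> (forall u v, e' u v -> e (f u) (f v)) ->
  residual_degree_le e a S -> residual_degree_le e' a (f @^-1: S).
Proof.
move=> fI fe dS v; rewrite inE => /dS; apply: leq_trans.
rewrite -(card_imset _ fI); apply: subset_leq_card.
apply/subsetP => _ /imsetP[w + ->]; rewrite !inE.
by move=> /andP[-> /fe->].
Qed.

(** The smaller grid sits in a corner of the larger one, and the trace of [S] on it is no larger
    than [S]. *)
Lemma not_residual_degree_le_grid n0 m0 n m a d (S : {set 'I_n * 'I_m}) :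
  no_light_extension n0 m0 a d [::] -> n0 <= n -> m0 <= m -> #|S| <= d ->
  ~ residual_degree_le (grid n m) a S.
Proof.
move=> low n0n m0m Sd.
pose f (v : 'I_n0 * 'I_m0) := (widen_ord n0n v.1, widen_ord m0m v.2).
have fI : injective f.
  by move=> [i j] [i' j'] [/val_inj-> /val_inj->].
move/(residual_degree_le_preim (e' := grid n0 m0) fI) => /(_ ltac:(by [])).
pose t := map (@coords n0 m0) (enum (f @^-1: S)).
have tS w : (coords w \in t) = (w \in f @^-1: S).
  by rewrite (mem_map (@coords_inj _ _)) mem_enum.
move/(residual_degree_coords a tS).
have := no_light_extensionP (t := t) low; rewrite cats0 => -> //.
rewrite size_map -cardE; apply: leq_trans Sd.
rewrite -(card_imset _ fI); apply: subset_leq_card.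
by apply/subsetP => _ /imsetP[w + ->]; rewrite inE.
Qed.

(** Points of [s] outside the grid are ignored, hence only an inequality for the size; one list can
    thus serve several values of [m]. *)
Lemma residual_degree_le_grid n m a s :
  uniq s -> ~~ has (heavy n m a s) (grid_points n m) ->
  exists2 S : {set 'I_n * 'I_m}, #|S| <= size s & residual_degree_le (grid n m) a S.
Proof.
move=> us; pose S := [set v : 'I_n * 'I_m | coords v \in s].
have sS w : (coords w \in s) = (w \in S) by rewrite inE.
move/(residual_degree_coords a sS) => dS; exists S => //.
rewrite cardE -(size_map (@coords n m)); apply: uniq_leq_size.
  by rewrite (map_inj_uniq (@coords_inj _ _)) enum_uniq.
by move=> _ /mapP[v + ->]; rewrite mem_enum inE.
Qed.

(** * Grid thresholds from a bad subgrid and a good opening *)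

Section GridThresholds.

Variables n m k n0 m0 : nat.
Hypotheses (n1 : 1 < n) (m1 : 1 < m) (n0n : n0 <= n) (m0m : m0 <= m).

Lemma grid_a1 (S : {set 'I_n * 'I_m}) :
  no_light_extension n0 m0 k k [::] ->
  #|S| <= k.+1 -> residual_degree_le (grid n m) k.+1 S -> is_a1 (grid n m) k.+1.
Proof.
move=> low Sk dS; apply: is_a1_residual_degree Sk dS _ => //.
- exact: grid_sym.
- exact: grid_irr.
- exact: (Ordinal (ltnW n1), Ordinal (ltnW m1)).
- by move=> p; exact: grid_neighbour.
- exact: grid_triangle_free.
- by move=> S'; exact: not_residual_degree_le_grid low n0n m0m.
Qed.

Lemma grid_a1' :
  no_light_extension n0 m0 k 0 [::] ->
  residual_degree_le (grid n m) k.+1 set0 -> is_a1' (grid n m) k.+1.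
Proof.
move=> low dk; apply: is_a1'_residual_degree dk _ => //.
- exact: grid_sym.
- exact: grid_irr.
- exact: (Ordinal (ltnW n1), Ordinal (ltnW m1)).
- by move=> p; exact: grid_neighbour.
- exact: grid_triangle_free.
- by apply: not_residual_degree_le_grid low n0n m0m _; rewrite cards0.
Qed.

End GridThresholds.

(** * Openings for Alice and certificates for Bob *)

Lemma grid_light_pair n m :
  ((n == 2) && (2 <= m <= 5)) || ((n == 3) && (m \in [:: 3; 4])) ->
  exists2 S : {set 'I_n * 'I_m}, #|S| <= 2 & residual_degree_le (grid n m) 2 S.
Proof.
(* In the 2x5 grid each of the six vertices of degree 3 is chosen or has a chosen neighbour; shorter
   grids use what remains of the pair. *)
have h2 : all (fun m => ~~ has (heavy 2 m 2 [:: (0, 1); (1, 3)])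
    (grid_points 2 m)) (iota 2 4) by vm_compute.
have h3 : all (fun m => ~~ has (heavy 3 m 2 [:: (1, 1); (1, 2)])
    (grid_points 3 m)) [:: 3; 4] by vm_compute.
case/orP=> /andP[/eqP-> hm].
  apply: (@residual_degree_le_grid _ _ _ [:: (0, 1); (1, 3)]) => //.
  by apply: (allP h2); rewrite mem_iota.
apply: (@residual_degree_le_grid _ _ _ [:: (1, 1); (1, 2)]) => //.
exact: (allP h3).
Qed.

(** Degrees up to 3 are allowed, so the three points only have to dominate the interior vertices,
    those of degree 4. In the 4x7 grid the ten interior vertices are dominated exactly once each. *)
Lemma grid_light_triple n m :
  [|| (n == 3) && (5 <= m <= 11), (n == 4) && (4 <= m <= 7)
    | (n == 5) && (m == 5)] ->
  exists2 S : {set 'I_n * 'I_m}, #|S| <= 3 & residual_degree_le (grid n m) 3 S.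
Proof.
have h3 : all (fun m => ~~ has (heavy 3 m 3 [:: (1, 2); (1, 5); (1, 8)])
    (grid_points 3 m)) (iota 5 7) by vm_compute.
have h4 : all (fun m => ~~ has (heavy 4 m 3 [:: (1, 1); (2, 3); (1, 5)])
    (grid_points 4 m)) (iota 4 4) by vm_compute.
case/or3P=> /andP[/eqP-> hm].
- apply: (@residual_degree_le_grid _ _ _ [:: (1, 2); (1, 5); (1, 8)]) => //.
  by apply: (allP h3); rewrite mem_iota.
- apply: (@residual_degree_le_grid _ _ _ [:: (1, 1); (2, 3); (1, 5)]) => //.
  by apply: (allP h4); rewrite mem_iota.
- rewrite (eqP hm).
  exact: (@residual_degree_le_grid _ _ _ [:: (2, 1); (1, 3); (3, 3)]).
Qed.

(** At depth 0 the search adds no point and merely finds a vertex of degree above the bound, as the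
    Bob-start game requires. *)
Lemma max_degree_2_2 : no_light_extension 2 2 1 0 [::].
Proof. by vm_compute. Qed.

Lemma max_degree_2_3 : no_light_extension 2 3 2 0 [::].
Proof. by vm_compute. Qed.

Lemma max_degree_3_3 : no_light_extension 3 3 3 0 [::].
Proof. by vm_compute. Qed.

Lemma no_light_set_2_2 : no_light_extension 2 2 1 1 [::].
Proof. by vm_compute. Qed.

Lemma no_light_set_2_6 : no_light_extension 2 6 2 2 [::].
Proof. by vm_compute. Qed.

Lemma no_light_set_3_5 : no_light_extension 3 5 2 2 [::].
Proof. by vm_compute. Qed.

Lemma no_light_set_4_4 : no_light_extension 4 4 2 2 [::].
Proof. by vm_compute. Qed.

(** The ten interior vertices form a path, and one vertex dominates at most three of them, so three
    do not suffice. *)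
Lemma no_light_set_3_12 : no_light_extension 3 12 3 3 [::].
Proof. by vm_compute. Qed.

Lemma no_light_set_4_8 : no_light_extension 4 8 3 3 [::].
Proof. by vm_compute. Qed.

Lemma no_light_set_5_6 : no_light_extension 5 6 3 3 [::].
Proof. by vm_compute. Qed.

Theorem theorem4p9 (n m : nat) (n_ge2 : 2 <= n) (n_le_m : n <= m) :
  is_a1 (cartesian_product (@path_graph n) (@path_graph m))
    (if ((n == 2) && (2 <= m <= 5)) || ((n == 3) && (m \in [:: 3; 4])) then 2
     else if [|| (n == 2) && (6 <= m), (n == 3) && (5 <= m <= 11),
                 (n == 4) && (4 <= m <= 7) | (n == 5) && (m == 5)] then 3
     else 4) /\
  is_a1' (cartesian_product (@path_graph n) (@path_graph m))
    (if (n == 2) && (m == 2) then 2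
     else if (n == 2) && (3 <= m) then 3
     else 4).
Proof.
have m1 : 1 < m by exact: leq_trans n_ge2 n_le_m.
have dk k : minn 2 n.-1 + minn 2 m.-1 <= k -> residual_degree_le (grid n m) k set0.
  exact: grid_residual_degree.
(* The Bob-start values come first: upper bounds from the maximum degree, lower bounds from the 2x2,
   2x3 and 3x3 subgrids. *)
split; last first.
  case: ifP => [c2|c2]; first by apply: (grid_a1' _ _ _ _ max_degree_2_2) (dk _ _); lia.
  case: ifP => [c3|c3]; first by apply: (grid_a1' _ _ _ _ max_degree_2_3) (dk _ _); lia.
  by apply: (grid_a1' _ _ _ _ max_degree_3_3) (dk _ _); lia.
(* Where the claimed value already bounds the maximum degree, the empty set serves as [S]. *)
have c0 k : #|@set0 ('I_n * 'I_m)%type| <= k by rewrite cards0.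
case: ifP => [/grid_light_pair[S S2 dS]|c2].
  exact: (grid_a1 _ _ _ _ no_light_set_2_2) S2 dS.
case: ifP => [|c3].
  case/orP=> [c3|/[dup] c3 /grid_light_triple[S S3 dS]].
    by apply: (grid_a1 _ _ _ _ no_light_set_2_6) (c0 _) (dk _ _); lia.
  have [n3|n4] : n = 3 \/ 4 <= n by lia.
    by apply: (grid_a1 _ _ _ _ no_light_set_3_5) S3 dS; lia.
  by apply: (grid_a1 _ _ _ _ no_light_set_4_4) S3 dS; lia.
rewrite !inE in c2.
(* The excluded cases leave [m >= 12] for [n = 3], [m >= 8] for [n = 4], and [m >= 6] for [n >= 5],
   since the 5x5 grid is excluded. *)
have [n3|[n4|n5]] : n = 3 \/ n = 4 \/ 5 <= n by lia.
- by apply: (grid_a1 _ _ _ _ no_light_set_3_12) (c0 _) (dk _ _); lia.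
- by apply: (grid_a1 _ _ _ _ no_light_set_4_8) (c0 _) (dk _ _); lia.
- by apply: (grid_a1 _ _ _ _ no_light_set_5_6) (c0 _) (dk _ _); lia.
Qed.
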